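(* The logic $\mathsf{C2.F}$ is sound and weakly complete for ordinal sequence models, and in fact for ordinal sequence models which are finite, closed under non-empty tailhood, and in which every sequence has length less than $\omega^\omega$. That is: (i) if $\vdash_{\mathsf{C2.F}}p$ then $p$ is true at every sequence in every ordinal sequence model; and (ii) for every $p\in\mathcal{L}_>$, if $p$ is true at every sequence in every ordinal sequence model $\langle W,\prec^W,V\rangle$ such that $W$ is finite, $W$ contains every non-empty tail of each of its members, and every member of $W$ has length less than $\omega^\omega$, then $\vdash_{\mathsf{C2.F}}p$.
   Context: Language. Let $At=\{p_0,p_1,\ldots\}$ be a countably infinite set of atoms. $\mathcal{L}_>$ is generated by $p ::= p_k\in At\mid \neg p\mid (p\wedge p)\mid (p>p)$; $\vee,\to,\leftrightarrow$ are defined as usual. Logics. $\mathsf{C2}$ is the smallest set of $\mathcal{L}_>$-sentences containing all instances of: (PC) every (substitution instance of a) theorem of classical propositional logic; (Identity) $p>p$; (Reciprocity) $(p>q)\wedge(q>p)\wedge(p>r)\to(q>r)$; (MP) $(p>q)\to(p\to q)$; (CEM) $(p>q)\vee(p>\neg q)$; and closed under (Detachment) from $\vdash p\to q$ and $\vdash p$ infer $\vdash q$; (Normality) from $\vdash(p\wedge q)\to r$ infer $\vdash((s>p)\wedge(s>q))\to(s>r)$. $\mathsf{C2.F}$ is the smallest extension of $\mathsf{C2}$ containing every instance of (Flattening) $(p>((p\wedge q)>r))\leftrightarrow((p\wedge q)>r)$ and closed under Detachment and Normality. $\vdash_{\mathsf{C2.F}}p$ means $p\in\mathsf{C2.F}$.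 Order frames and models. An order frame is a pair $\langle W,<\rangle$ where $W\neq\varnothing$ and $<$ is a function taking each $w\in W$ to a strict well-order $<_w$ on some subset of $W$ such that whenever $x<_w y$, either $w=x$ or $w<_w x$. Put $R(w)=\{w\}\cup\{v: w<_w v\}$. An order model $\langle W,<,V\rangle$ adds a valuation $V:At\times W\to\{0,1\}$; put $V(p_k)=\{w:V(p_k,w)=1\}$. Denotations: $[\![p_k]\!]=V(p_k)$, $[\![\neg p]\!]=W\setminus[\![p]\!]$, $[\![p\wedge q]\!]=[\![p]\!]\cap[\![q]\!]$, and $w\in[\![p>q]\!]$ iff either $R(w)\cap[\![p]\!]=\varnothing$, or there is $y\in R(w)\cap[\![p]\!]\cap[\![q]\!]$ such that $x\notin[\![p]\!]$ whenever $x<_w y$. A sentence $p$ is true at $w$ iff $w\in[\![p]\!]$. Ordinal sequences. For an ordinal $\alpha$ and non-empty set $P$, an $\alpha$-sequence over $P$ is a function $\sigma:\alpha\to P$; $\alpha$ is its length. An ordinal sequence is an $\alpha$-sequence for some ordinal $\alpha$. For $\beta\le\alpha$ the $\beta$th tail $\sigma^{[\beta:]}$ is the sequence of length $\alpha-\beta$ with $\sigma^{[\beta:]}(\gamma)=\sigma(\beta+\gamma)$; the rank in $\sigma$ of a tail $\tau$ of $\sigma$ is the least $\beta$ with $\tau=\sigma^{[\beta:]}$. The tail order function $\prec^W$ on a set $W$ of ordinal sequences has $\tau\prec^W_\sigma\rho$ iff $\tau,\rho,\sigma\in W$, $\tau$ and $\rho$ are tails of $\sigma$, and the rank of $\tau$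 in $\sigma$ is less than the rank of $\rho$ in $\sigma$. An ordinal sequence frame is an order frame $\langle W,\prec^W\rangle$ where $W$ is a set of ordinal sequences (finite or transfinite; $W$ is not required to be closed under tails or to exclude the empty sequence). An ordinal sequence model is an order model based on an ordinal sequence frame. *)

(* Defs.v *)
From HB Require Import structures.
From mathcomp Require Import all_boot all_order.
From mathcomp Require Import all_classical.

Set Implicit Arguments.
Unset Strict Implicit.
Unset Printing Implicit Defensive.

Import Order.TTheory.

Local Open Scope classical_set_scope.

Inductive form : Type :=
  | Atom of nat
  | Neg of form
  | Conj of form & form
  | Cond of form & form.

Declare Scope form_scope.
Delimit Scope form_scope with F.
Bind Scope form_scope with form.

Definition Disj (p q : form) : form := Neg (Conj (Neg p) (Neg q)).
Definition Impl (p q : form) : form := Neg (Conj p (Neg q)).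
Definition Iff (p q : form) : form := Conj (Impl p q) (Impl q p).

Notation "¬ p" := (Neg p) (at level 35, right associativity) : form_scope.
Notation "p ▷ q" := (Cond p q) (at level 37, no associativity) : form_scope.
Notation "p ∧ q" := (Conj p q) (at level 39, left associativity) : form_scope.
Notation "p ∨ q" := (Disj p q) (at level 40, left associativity) : form_scope.
Notation "p ⊃ q" := (Impl p q) (at level 41, right associativity) : form_scope.
Notation "p ≡ q" := (Iff p q) (at level 42, no associativity) : form_scope.

(* The theorems of classical propositional logic are its tautologies; their
   substitution instances are the [psubst s a] with [tautology a]. *)
Inductive pform : Type :=
  | PVar of nat
  | PNeg of pform
  | PConj of pform & pform.

Fixpoint peval (v : nat -> bool) (a : pform) : bool :=
  match a with
  | PVar k => v k
  | PNeg a => ~~ peval v a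
  | PConj a b => peval v a && peval v b
  end.

Definition tautology (a : pform) : Prop := forall v, peval v a.

Fixpoint psubst (s : nat -> form) (a : pform) : form :=
  match a with
  | PVar k => s k
  | PNeg a => Neg (psubst s a)
  | PConj a b => Conj (psubst s a) (psubst s b)
  end.

Inductive C2 : form -> Prop :=
  | C2_PC a s : tautology a -> C2 (psubst s a)
  | C2_identity p : C2 (p ▷ p)
  | C2_reciprocity p q r : C2 ((p ▷ q) ∧ (q ▷ p) ∧ (p ▷ r) ⊃ (q ▷ r))
  | C2_MP p q : C2 ((p ▷ q) ⊃ (p ⊃ q))
  | C2_CEM p q : C2 ((p ▷ q) ∨ (p ▷ ¬ q))
  | C2_detachment p q : C2 (p ⊃ q) -> C2 p -> C2 q
  | C2_normality p q r s : C2 (p ∧ q ⊃ r) -> C2 ((s ▷ p) ∧ (s ▷ q) ⊃ (s ▷ r)).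

Inductive C2F : form -> Prop :=
  | C2F_C2 p : C2 p -> C2F p
  | C2F_flattening p q r :
      C2F ((p ▷ ((p ∧ q) ▷ r)) ≡ ((p ∧ q) ▷ r))
  | C2F_detachment p q : C2F (p ⊃ q) -> C2F p -> C2F q
  | C2F_normality p q r s :
      C2F (p ∧ q ⊃ r) -> C2F ((s ▷ p) ∧ (s ▷ q) ⊃ (s ▷ r)).

Record strict_well_order_on (T : Type) (S : set T) (R : T -> T -> Prop) :
    Prop := StrictWellOrderOn {
  swo_field : forall x y, R x y -> S x /\ S y;
  swo_irr : forall x, ~ R x x;
  swo_trans : forall x y z, R x y -> R y z -> R x z;
  swo_total : forall x y, S x -> S y -> [\/ R x y, x = y | R y x];
  swo_least : forall X : set T, X `<=` S -> X !=set0 ->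
    exists2 m, X m & forall x, X x -> ~ R x m }.

Record orderFrame : Type := OrderFrame {
  world :> Type;
  before : world -> world -> world -> Prop;  (* [before w x y] is x <_w y *)
  world_inhabited : inhabited world;
  before_swo : forall w, exists S : set world,
    strict_well_order_on S (before w);
  before_start : forall w x y, before w x y -> w = x \/ before w w x }.

Definition reach (F : orderFrame) (w : F) : set F :=
  w |` [set v | before w w v].

Fixpoint denot (F : orderFrame) (V : nat -> F -> bool) (p : form) : set F :=
  match p with
  | Atom k => [set w | V k w]
  | Neg p => ~` denot V p
  | Conj p q => denot V p `&` denot V q
  | Cond p q => [set w |
      reach w `&` denot V p = set0 \/
      exists2 y, (reach w `&` denot V p `&` denot V q) y &
                 forall x, before w x y -> ~ denot V p x]
  end.

Definition true_at (F : orderFrame) (V : nat -> F -> bool) (p : form) (w : F) :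
  Prop := denot V p w.

(* [Node f] denotes the least ordinal above all [f a]; every ordinal arises
   in this way, from many trees, so that ordinals are trees modulo [tle]. *)
Inductive otree : Type := Node (A : Type) (f : A -> otree).

Definition branches (t : otree) : Type := let: Node A _ := t in A.
Definition branch (t : otree) : branches t -> otree :=
  match t with Node _ f => f end.

Fixpoint tle (x y : otree) : Prop :=
  match x, y with
  | Node _ f, Node _ g => forall a, exists b, tle (f a) (g b)
  end.

Definition tlt (x y : otree) : Prop := exists b, tle x (@branch y b).

(* x + y = x \cup {x + z : z < y} *)
Fixpoint tadd (x y : otree) : otree :=
  match y with
  | Node _ g => Node (fun i : branches x + _ =>
      match i with inl a => branch a | inr b => tadd x (g b) end)
  end.

(* x - y = {z - y : y <= z < x}, the z such that y + z = x when y <= x *)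
Fixpoint tsub (x y : otree) : otree :=
  match x with
  | Node _ f => Node (fun i : {a | tle y (f a)} => tsub (f (sval i)) y)
  end.

(* x * y = {x * z + u : z < y, u < x} *)
Fixpoint tmul (x y : otree) : otree :=
  match y with
  | Node _ g => Node (fun i : _ * branches x => tadd (tmul x (g i.1)) (branch i.2))
  end.

Definition tsup (A : Type) (f : A -> otree) : otree :=
  Node (fun i : {a & branches (f a)} => branch (tagged i)).

Definition tzero : otree := Node (fun i : void => match i with end).
Definition tsucc (x : otree) : otree := Node (fun _ : unit => x).
Definition tone : otree := tsucc tzero.
Definition tnat (n : nat) : otree := iter n tsucc tzero.
Definition tomega : otree := Node tnat.

Definition tomega_pow (n : nat) : otree := iter n (tmul^~ tomega) tone.
Definition tomega_omega : otree := tsup tomega_pow.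

Lemma tle_refl x : tle x x.
Proof. by elim: x => A f IH /= a; exists a; apply: IH. Qed.

Lemma tle_trans y x z : tle x y -> tle y z -> tle x z.
Proof.
elim: y x z => B g IH [A f] [C h] /= fg gh a.
have [b fgab] := fg a; have [c ghbc] := gh b.
by exists c; apply: IH fgab ghbc.
Qed.

Lemma tleP x y : tle x y <-> forall a, tlt (@branch x a) y.
Proof. by case: x y => [A f] [B g]. Qed.

Lemma tltP x y : tlt x y <-> ~ tle y x.
Proof.
elim: x y => A f IH y; split.
  move=> [b /tleP fb] /tleP /(_ b) [a yb_le].
  by have [/(_ (fb a))] := IH a (branch b).
move=> /tleP /existsNP [b /= nb]; exists b; apply/tleP => a /=.
by apply/IH => le_ba; apply: nb; exists a.
Qed.

Lemma tlt_le x y : tlt x y -> tle x y.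
Proof.
elim: x y => A f IH y [b fb]; apply/tleP => a /=; exists b.
by apply: IH; move/tleP: fb; apply.
Qed.

Lemma tle_total x y : tle x y \/ tle y x.
Proof.
by have [?|/tltP/tlt_le] := pselect (tle y x); [right|left].
Qed.

HB.instance Definition _ := gen_eqMixin otree.
HB.instance Definition _ := gen_choiceMixin otree.

Definition teqv : rel otree := fun x y => `[< tle x y /\ tle y x >].

Lemma teqv_refl : reflexive teqv.
Proof. by move=> x; apply/asboolP; split; apply: tle_refl. Qed.

Lemma teqv_sym : symmetric teqv.
Proof. by move=> x y; apply/asbool_equiv_eq; split=> -[]. Qed.

Lemma teqv_trans : transitive teqv.
Proof.
move=> y x z /asboolP[xy yx] /asboolP[yz zy]; apply/asboolP.
by split; [apply: tle_trans xy yz | apply: tle_trans zy yx].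
Qed.

Canonical teqv_equiv := EquivRel teqv teqv_refl teqv_sym teqv_trans.

Lemma tlt_trans_le y x z : tlt x y -> tle y z -> tlt x z.
Proof.
case: y => B g [b xb] /tleP /(_ b) /= [c bc]; exists c; exact: tle_trans xb bc.
Qed.

Lemma tle_lt_trans y x z : tle x y -> tlt y z -> tlt x z.
Proof. by move=> xy [c yc]; exists c; apply: tle_trans xy yc. Qed.

Lemma tlt_branch x a : tlt (@branch x a) x.
Proof. by exists a; apply: tle_refl. Qed.

Lemma tle_addr x y : tle x (tadd x y).
Proof.
by apply/tleP => a; case: y => B g; exists (inl a); apply: tle_refl.
Qed.

Lemma tle_addP x y z :
  tle (tadd x y) z <-> tle x z /\ forall b, tlt (tadd x (@branch y b)) z.
Proof.
case: y => B g; split=> [h|].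
  split; first exact: tle_trans (tle_addr x (Node g)) h.
  by move=> b; have /(_ (inr b)) := (tleP _ _).1 h.
by move=> [xz h]; apply/tleP => -[a|b]; [exact: ((tleP x z).1 xz a)|exact: h].
Qed.

Lemma tlt_add2l x y z : tlt y z -> tlt (tadd x y) (tadd x z).
Proof.
elim: y z => A f IH [B g] [b] /tleP ygb; exists (inr b).
apply: (tle_addP _ _ _).2; split; first exact: tle_addr.
by move=> a; apply: IH; apply: ygb.
Qed.

Lemma tle_add2l x y z : tle y z -> tle (tadd x y) (tadd x z).
Proof.
move=> /tleP yz; apply/tle_addP; split; first exact: tle_addr.
by move=> b; apply: tlt_add2l; apply: yz.
Qed.

Lemma tle_add2r x y z : tle x y -> tle (tadd x z) (tadd y z).
Proof.
move=> xy; elim: z => C h IH; apply/tle_addP; split.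
  exact: tle_trans xy (tle_addr _ _).
by move=> c; exists (inr c); apply: IH.
Qed.

Lemma tadd0l x : tle (tadd tzero x) x /\ tle x (tadd tzero x).
Proof.
elim: x => A f IH; split.
  by apply/tle_addP; split=> [[]|a]; exists a; case: (IH a).
by move=> a; exists (inr a); case: (IH a).
Qed.

Lemma tlt_subP x y z : tlt z (tsub x y) <-> tlt (tadd y z) x.
Proof.
elim: x z => A f IH z.
have sub_le a : tle y (f a) -> tle z (tsub (f a) y) <-> tle (tadd y z) (f a).
  move=> yfa; split=> [/tleP h|/tle_addP[_ h]].
    by apply/tle_addP; split=> // c; apply/IH.
  by apply/tleP => c; apply/IH.
split=> [[[a yfa]]|[a]] /= h; first by exists a; apply/sub_le.
have yfa : tle y (f a) by apply: tle_trans (tle_addr _ _) h.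
by exists (exist _ a yfa); apply/sub_le.
Qed.

Lemma tle_subP x y z : tle y x -> tle z (tsub x y) <-> tle (tadd y z) x.
Proof.
move=> yx; split=> [/tleP h|/tle_addP[_ h]].
  by apply/tle_addP; split=> // c; apply/tlt_subP.
by apply/tleP => c; apply/tlt_subP.
Qed.

Lemma tlt_supP (A : Type) (f : A -> otree) x :
  tlt x (tsup f) <-> exists a, tlt x (f a).
Proof.
split=> [[[a b] /= xb]|[a [b xb]]]; first by exists a, b.
by exists (existT _ a b).
Qed.

Lemma tlt_wf : well_founded tlt.
Proof.
move=> x; suff: forall y, tle y x -> Acc tlt y by apply; apply: tle_refl.
elim: x => A f IH y yx; constructor=> z zy.
by have [a zfa] := tlt_trans_le zy yx; apply: IH zfa.
Qed.

Local Open Scope quotient_scope.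

Definition Ord : Type := {eq_quot teqv}.
HB.instance Definition _ := Choice.on Ord.
HB.instance Definition _ := EqQuotient.on Ord.

Definition ord_of (t : otree) : Ord := \pi_Ord t.

Definition ole : rel Ord := fun x y => `[< tle (repr x) (repr y) >].

Lemma repr_ord_of t : tle (repr (ord_of t)) t /\ tle t (repr (ord_of t)).
Proof. by apply/asboolP; apply/(@eqmodP _ teqv_equiv); rewrite reprK. Qed.

Lemma ole_refl : reflexive ole.
Proof. by move=> x; apply/asboolP/tle_refl. Qed.

Lemma ole_anti : antisymmetric ole.
Proof.
move=> x y /andP[/asboolP xy /asboolP yx].
rewrite -[x]reprK -[y]reprK; apply/eqmodP.
by apply/asboolP.
Qed.

Lemma ole_trans : transitive ole.
Proof.
move=> y x z /asboolP xy /asboolP yz; apply/asboolP; exact: tle_trans xy yz.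
Qed.

Lemma ole_total : total ole.
Proof.
move=> x y; apply/orP.
by have [?|?] := tle_total (repr x) (repr y); [left|right]; apply/asboolP.
Qed.

Fact ord_display : Order.disp_t. Proof. exact: Order.default_display. Qed.

HB.instance Definition _ :=
  Order.Le_isPOrder.Build ord_display Ord ole_refl ole_anti ole_trans.
HB.instance Definition _ := Order.POrder_isTotal.Build ord_display Ord ole_total.

Definition ozero : Ord := ord_of tzero.
Definition oadd (x y : Ord) : Ord := ord_of (tadd (repr x) (repr y)).
Definition osub (x y : Ord) : Ord := ord_of (tsub (repr x) (repr y)).
Definition omega_omega : Ord := ord_of tomega_omega.

Local Open Scope order_scope.

Lemma ltEtlt (x y : Ord) : (x < y) = `[< tlt (repr x) (repr y) >].
Proof.
rewrite ltNge; apply/negP/asboolP; rewrite tltP.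
  by move=> h yx; apply: h; apply/asboolP.
by move=> h /asboolP.
Qed.

Lemma le_ord_of s t : (ord_of s <= ord_of t) = `[< tle s t >].
Proof.
have [s1 s2] := repr_ord_of s; have [t1 t2] := repr_ord_of t.
apply: asbool_equiv_eq; split=> h.
  exact: tle_trans s2 (tle_trans h t1).
exact: tle_trans s1 (tle_trans h t2).
Qed.

Lemma lt_ord_of s t : (ord_of s < ord_of t) = `[< tlt s t >].
Proof.
rewrite ltNge le_ord_of; apply/negP/asboolP; rewrite tltP.
  by move=> h yx; apply: h; apply/asboolP.
by move=> h /asboolP.
Qed.

Lemma oadd_ord_of s t : oadd (ord_of s) (ord_of t) = ord_of (tadd s t).
Proof.
have [s1 s2] := repr_ord_of s; have [t1 t2] := repr_ord_of t.
apply/eqP; rewrite eq_le !le_ord_of; apply/andP; split; apply/asboolP.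
  exact: tle_trans (tle_add2l _ t1) (tle_add2r _ s1).
exact: tle_trans (tle_add2l _ t2) (tle_add2r _ s2).
Qed.

Lemma ord_ofK (x : Ord) : ord_of (repr x) = x.
Proof. exact: reprK. Qed.

Lemma lt_omega_omega (x : Ord) :
  x < omega_omega <-> exists n, x < ord_of (tomega_pow n).
Proof.
rewrite -[x]ord_ofK; split=> [|[n]]; rewrite lt_ord_of => /asboolP h.
  by have [n xn] := (tlt_supP _ _).1 h; exists n; rewrite lt_ord_of; apply/asboolP.
by rewrite lt_ord_of; apply/asboolP/tlt_supP; exists n.
Qed.

Lemma ole0x (x : Ord) : ozero <= x.
Proof. by rewrite -[x]ord_ofK le_ord_of; apply/asboolP/tleP => -[]. Qed.

Lemma oadd0x : left_id ozero oadd.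
Proof.
move=> x; rewrite -[x]ord_ofK oadd_ord_of; have [h1 h2] := tadd0l (repr x).
by apply/eqP; rewrite eq_le !le_ord_of; apply/andP; split; apply/asboolP.
Qed.

Lemma olt_osub (x y z : Ord) : (z < osub x y) = (oadd y z < x).
Proof.
rewrite -[z]ord_ofK -[y in RHS]ord_ofK -[x in RHS]ord_ofK oadd_ord_of.
by rewrite !lt_ord_of; apply: asbool_equiv_eq; apply: tlt_subP.
Qed.

Lemma oadd_osub (x y : Ord) : y <= x -> oadd y (osub x y) = x.
Proof.
move=> yx; apply/eqP; rewrite eq_le; apply/andP; split; last first.
  by rewrite leNgt -olt_osub ltxx.
rewrite -[y in oadd y]ord_ofK -[x in leRHS]ord_ofK oadd_ord_of le_ord_of.
by apply/asboolP/tle_subP; [apply/asboolP|apply: tle_refl].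
Qed.

Lemma ord_least (X : set Ord) : X !=set0 ->
  exists2 m, X m & forall x, X x -> m <= x.
Proof.
move=> [x Xx]; move: {2}(repr x) (erefl (repr x)) => t.
elim/(well_founded_ind tlt_wf): t x Xx => t IH x Xx xt.
have [|/existsNP[y /not_implyP[Xy]]] := pselect (forall y, X y -> x <= y).
  by exists x.
move=> /negP; rewrite -ltNge ltEtlt xt => /asboolP yx.
exact: IH _ yx y Xy erefl.
Qed.

(* A function from the ordinal [olen] to [P], encoded as a partial function on
   ordinals with domain [olen], so that sequences with the same length and the
   same values are Leibniz equal. *)
Record oseq (P : Type) : Type := OSeq {
  olen : Ord;
  oval : Ord -> option P;
  oval_dom : forall c, isSome (oval c) = (c < olen) }.

Lemma oseq_ext (P : Type) (s t : oseq P) :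
  (forall c, oval s c = oval t c) -> s = t.
Proof.
case: s t => [l f fl] [m g gm] /= /funext fg.
case: _ / fg in gm *.
have lm : l = m.
  have lm c : (c < l) = (c < m) by rewrite -fl gm.
  by apply/eqP; rewrite eq_le !leNgt (lm m) -(lm l) !ltxx.
case: _ / lm in gm *.
by congr OSeq; apply: Prop_irrelevance.
Qed.

Section Tails.
Variables (P : Type) (s : oseq P) (b : Ord).

Fact otail_dom c :
  isSome (oval s (oadd b c)) = (c < osub (olen s) b).
Proof. by rewrite oval_dom olt_osub. Qed.

Definition otail : oseq P := OSeq otail_dom.

End Tails.

Lemma otail0 (P : Type) (s : oseq P) : otail s ozero = s.
Proof. by apply: oseq_ext => c /=; rewrite oadd0x. Qed.

(* [t] is a tail of [s], and its rank in [s] is [b]. *)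
Definition tail_rank (P : Type) (s t : oseq P) (b : Ord) : Prop :=
  [/\ b <= olen s, t = otail s b &
      forall c, c <= olen s -> t = otail s c -> b <= c].

Lemma tail_rank_uniq (P : Type) (s t : oseq P) b c :
  tail_rank s t b -> tail_rank s t c -> b = c.
Proof.
move=> [bs tb b_min] [cs tc c_min].
by apply/eqP; rewrite eq_le b_min // c_min.
Qed.

Lemma tail_rank_inj (P : Type) (s t u : oseq P) b :
  tail_rank s t b -> tail_rank s u b -> t = u.
Proof. by move=> [_ -> _] [_ -> _]. Qed.

Lemma tail_rank_refl (P : Type) (s : oseq P) : tail_rank s s ozero.
Proof. by split=> [||c _ _]; rewrite ?otail0 ?ole0x. Qed.

Definition tail_order (P : Type) (W : set (oseq P)) (s t u : W) : Prop :=
  exists b c, [/\ tail_rank (\val s) (\val t) b,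
                  tail_rank (\val s) (\val u) c & b < c].

Section SeqFrame.
Variables (P : Type) (W : set (oseq P)) (W0 : W !=set0).

Fact seqFrame_inhabited : inhabited W.
Proof. by case: W0 => s Ws; constructor; exists s; apply/mem_set. Qed.

Fact seqFrame_swo (s : W) : exists S : set W,
  strict_well_order_on S (tail_order s).
Proof.
exists [set t | exists b, tail_rank (\val s) (\val t) b]; split.
- by move=> t u [b [c [tb uc _]]]; split; [exists b|exists c].
- by move=> t [b [c [tb tc]]]; rewrite (tail_rank_uniq tb tc) ltxx.
- move=> t u v [b [c [tb uc bc]]] [c' [d [uc' vd]]].
  rewrite -(tail_rank_uniq uc uc') => cd.
  by exists b, d; split=> //; apply: lt_trans cd.
- move=> t u [b tb] [c uc]; case: (ltgtP b c) => bc.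
  + by constructor 1; exists b, c.
  + by constructor 3; exists c, b.
  + constructor 2; apply: val_inj; rewrite bc in tb.
    exact: tail_rank_inj tb uc.
- move=> X XS [t Xt].
  have [|b [u Xu ub] b_min] :=
    @ord_least [set b | exists2 t, X t & tail_rank (\val s) (\val t) b].
    by have [b tb] := XS t Xt; exists b, t.
  exists u => // v Xv [c [d [vc ud]]]; rewrite -(tail_rank_uniq ub ud) ltNge.
  by rewrite b_min//; exists v.
Qed.

Fact seqFrame_start (s t u : W) :
  tail_order s t u -> s = t \/ tail_order s s t.
Proof.
move=> [b [_ [tb _ _]]]; have [b0|b0] := eqVneq b ozero.
  left; apply: val_inj; rewrite b0 in tb.
  exact: tail_rank_inj (tail_rank_refl _) tb.
right; exists ozero, b; split=> //; first exact: tail_rank_refl.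
by rewrite lt_neqAle eq_sym b0 ole0x.
Qed.

Definition seqFrame : orderFrame :=
  OrderFrame seqFrame_inhabited seqFrame_swo seqFrame_start.

End SeqFrame.

Definition tail_closed (P : Type) (W : set (oseq P)) : Prop :=
  forall s b, W s -> b <= olen s -> olen (otail s b) != ozero ->
    W (otail s b).

(* Main.v *)
(* Soundness: in an ordinal sequence frame, if [x] is the first [A]-tail of [w],
   then the tails of [w] lying in a set [B] included in [A] are those of [x] lying
   in [B], in the same order of rank; this validates Flattening.

   Completeness: fix a finite set [L] of sentences closed under subsentences and
   call the trace of a maximal consistent set (MCS) on [L] its cell. Since
   conditioning an MCS [w] on a consistent antecedent gives an MCS
   [{q | A > q \in w}], each MCS lists the cells accessible from it in the order
   in which it would select them; call this list its type. Flattening yields: for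
   a type [t] and a set [A] of cells not containing all of [t], some type starts
   outside [A] and agrees with [t] outside [A]. There are finitely many types, and
   a transfinite walk through them is defined as follows: at stage [a] > 0, take a
   type [u] visited cofinally often below [a], let [A] be the set of cells at the
   head of the types visited cofinally below [a], and move to a type that starts
   outside [A] and agrees with [u] outside [A]; stop when [A] contains all of [u].
   The walk from [x] visits the cells of [x] in the order in which [x] lists them.
   It is memoryless, so each of its tails is the walk from another type and there
   are finitely many tails. Reaching stage [omega ^ n] takes at least [n + 1]
   cells, so the walk stops before [omega ^ omega]. *)
From HB Require Import structures.
Require Import Defs.
From mathcomp Require Import all_boot all_order.
From mathcomp Require Import all_classical.

Set Implicit Arguments.
Unset Strict Implicit.
Unset Printing Implicit Defensive.

Import Order.TTheory.

Local Open Scope classical_set_scope.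
Local Open Scope order_scope.

Definition first_in (F : orderFrame) (w : F) (A : set F) (y : F) : Prop :=
  [/\ reach w y, A y & forall x, before w x y -> ~ A x].

(** * Soundness *)

Section OrderFrame.
Variable F : orderFrame.
Implicit Types (w x y : F) (A B : set F).

Lemma not_before_start w x : ~ before w x w.
Proof.
move=> xw; have [S swo] := before_swo w.
have [wx|wx] := before_start xw; first by rewrite -wx in xw; case: (swo_irr swo xw).
by case: (swo_irr swo (swo_trans swo xw wx)).
Qed.

Lemma reach_total w x y :
  reach w x -> reach w y -> [\/ before w x y, x = y | before w y x].
Proof.
have [S swo] := before_swo w.
move=> [->|/= wx] [->|/= wy]; first by constructor 2.
- by constructor 1.
- by constructor 3.
have [_ Sx] := swo_field swo wx; have [_ Sy] := swo_field swo wy.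
exact: (swo_total swo Sx Sy).
Qed.

Lemma first_in_uniq w A x y : first_in w A x -> first_in w A y -> x = y.
Proof.
move=> [rx Ax xmin] [ry Ay ymin].
have [/ymin//|//|/xmin//] := reach_total rx ry.
Qed.

Lemma first_in_start w A : A w -> first_in w A w.
Proof. by move=> Aw; split=> // [|x /not_before_start//]; left. Qed.

(** The field of the order at [w] may omit [w], so the case [A w] is settled apart. Otherwise take
    the least strict successor of [w] in [A]: by [before_start], whatever precedes it is [w] or a
    strict successor of [w]. *)
Lemma first_in_ex w A x : reach w x -> A x -> exists y, first_in w A y.
Proof.
have [S swo] := before_swo w; move=> rx Ax.
have [Aw|nAw] := pselect (A w); first by exists w; apply: first_in_start.
have [||m [wm Am] m_min] := swo_least swo (X := [set v | before w w v /\ A v]).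
- by move=> v [/(swo_field swo)[]].
- by exists x; split=> //; case: rx Ax nAw => // ->.
exists m; split=> // [|z zm Az]; first by right.
have [wz|wz] := before_start zm; first by apply: nAw; rewrite wz.
exact: m_min z (conj wz Az) zm.
Qed.

Lemma denot_cond V p q w : denot V (Cond p q) w <->
  forall y, first_in w (denot V p) y -> denot V q y.
Proof.
split=> /= [[e y [ry py _]|[y [[ry py] qy] ymin] z zfirst]|h].
- by have : set0 y by rewrite -e.
- by rewrite (first_in_uniq zfirst (And3 ry py ymin)).
have [[y [ry py]]|none] := pselect (exists y, (reach w `&` denot V p) y).
  have [z zfirst] := first_in_ex ry py; right; exists z.
    by split; [case: zfirst | exact: h].
  by case: zfirst.
by left; rewrite -subset0 => y py; apply: none; exists y.
Qed.

Lemma denot_impl (V : nat -> F -> bool) p q w :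
  denot V (Impl p q) w <-> (denot V p w -> denot V q w).
Proof.
split=> /= [h pw|h [pw]]; last by apply; exact: h.
by apply: contrapT => nq; apply: h.
Qed.

Lemma denot_psubst (V : nat -> F -> bool) s a w :
  denot V (psubst s a) w <-> peval (fun k => `[< denot V (s k) w >]) a.
Proof.
elim: a => [k|a IH|a IHa b IHb] /=; first by split=> /asboolP.
  by split=> [h|/negP h /IH //]; apply/negP => /IH.
by split=> [[/IHa -> /IHb ->]|/andP[/IHa ? /IHb ?]].
Qed.

Lemma C2_sound V p w : C2 p -> denot (F := F) V p w.
Proof.
move=> Cp; elim: Cp w =>
  {p} [a s ta|p|p q r|p q|p q|p q _ IHpq _ IHp|p q r s _ IH] w.
- by apply/denot_psubst; apply: ta.
- by apply/denot_cond => y [].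
- apply/denot_impl => -[[/denot_cond pq /denot_cond qp] /denot_cond pr].
  apply/denot_cond => y yq; have py := qp _ yq; apply: pr.
  (* Reciprocity: the first [q]-world [y] satisfies [p], and the first [p]-world [z] satisfies [q].
     Neither can precede the other, so they coincide. *)
  have [ry qy ymin] := yq; have [z zp] := first_in_ex ry py.
  have [rz _ zmin] := zp; have qz := pq _ zp.
  by have [/zmin//|->//|/ymin//] := reach_total ry rz.
- apply/denot_impl => /denot_cond pq; apply/denot_impl => pw; apply: pq.
  exact: first_in_start.
- move=> [npq npnq]; apply: npnq; apply/(denot_cond V p (Neg q)) => y yp qy.
  by apply: npq; apply/(denot_cond V p q) => z /(first_in_uniq yp) <-.
- by move/denot_impl: (IHpq w); apply.
- apply/denot_impl => -[/denot_cond sp /denot_cond sq].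
  by apply/denot_cond => y ys; move/denot_impl: (IH y); apply; split; auto.
Qed.

(** The frame condition behind Flattening, with [A] in the role of [p] and [B] in that of
    [p ∧ q]. *)
Definition flat : Prop := forall w x A B,
  first_in w A x -> B `<=` A -> forall y, first_in w B y <-> first_in x B y.

Lemma C2F_sound V p w : flat -> C2F p -> denot (F := F) V p w.
Proof.
move=> flatF Cp; elim: Cp w => {p} [p Cp|p q r|p q _ IHpq _ IHp|p q r s _ IH] w.
- exact: C2_sound.
- have sub : denot V (Conj p q) `<=` denot V p by move=> y [].
  split; apply/denot_impl => /denot_cond h; apply/denot_cond => y yf.
    have [ry [py _] _] := yf; have [x xf] := first_in_ex ry py.
    have /denot_cond := h x xf; apply.
    exact/(flatF w x _ _ xf sub).
  by apply/denot_cond => z /(flatF w y _ _ yf sub); apply: h.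
- by move/denot_impl: (IHpq w); apply.
- apply/denot_impl => -[/denot_cond sp /denot_cond sq].
  by apply/denot_cond => y ys; move/denot_impl: (IH y); apply; split; auto.
Qed.

End OrderFrame.

(** * Well-foundedness and arithmetic of ordinals *)

Lemma ord_wf : well_founded (fun a b : Ord => a < b).
Proof.
move=> a; apply: contrapT => na.
have [|b nb b_min] := @ord_least [set b | ~ Acc (fun a b : Ord => a < b) b].
  by exists a.
apply: nb; constructor=> c cb; apply: contrapT => /b_min.
by rewrite leNgt cb.
Qed.

Section OrdinalSum.
Implicit Types a b c : Ord.

Lemma ogt0 a : (ozero < a) = (a != ozero).
Proof. by rewrite lt_neqAle eq_sym ole0x andbT. Qed.

Lemma lt_oadd2l a b c : (oadd a b < oadd a c) = (b < c).
Proof.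
have mono x y : x < y -> oadd a x < oadd a y.
  rewrite -[a]ord_ofK -[x]ord_ofK -[y]ord_ofK !oadd_ord_of !lt_ord_of.
  by move=> /asboolP xy; apply/asboolP; apply: tlt_add2l.
case: (ltgtP b c) => [/mono//|/mono|->]; last by rewrite ltxx.
by move=> /ltW; rewrite leNgt => /negbTE.
Qed.

Lemma le_oadd2l a b c : (oadd a b <= oadd a c) = (b <= c).
Proof. by rewrite !leNgt lt_oadd2l. Qed.

Lemma le_oaddr a b : a <= oadd a b.
Proof.
rewrite -[a]ord_ofK -[b]ord_ofK oadd_ord_of le_ord_of; apply/asboolP.
exact: tle_addr.
Qed.

Lemma oaddx0 a : oadd a ozero = a.
Proof.
apply/eqP; rewrite eq_le le_oaddr andbT -{2}(oadd_osub (lexx a)) le_oadd2l.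
exact: ole0x.
Qed.

Lemma oaddA a b c : oadd a (oadd b c) = oadd (oadd a b) c.
Proof.
have assoc x y z : tle (tadd x (tadd y z)) (tadd (tadd x y) z) /\
                   tle (tadd (tadd x y) z) (tadd x (tadd y z)).
  elim: z => C h IH; split; apply/tle_addP; split.
  - exact: tle_trans (tle_addr x y) (tle_addr _ _).
  - case=> [d|d] /=.
      apply: tlt_trans_le (tle_addr (tadd x y) (Node h)).
      exact/tlt_add2l/tlt_branch.
    by exists (inr d); case: (IH d).
  - exact/tle_add2l/tle_addr.
  - by move=> d; exists (inr (inr d)); case: (IH d).
rewrite -[a]ord_ofK -[b]ord_ofK -[c]ord_ofK !oadd_ord_of.
have [h1 h2] := assoc (repr a) (repr b) (repr c).
by apply/eqP; rewrite eq_le !le_ord_of; apply/andP; split; apply/asboolP.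
Qed.

Lemma le_osub a b c : a <= c -> (b <= osub c a) = (oadd a b <= c).
Proof. by move=> ac; rewrite -(le_oadd2l a) oadd_osub. Qed.

Lemma oadd_neq0 a b : b != ozero -> oadd a b != ozero.
Proof.
move=> b0; rewrite -ogt0.
apply: le_lt_trans (ole0x a) _; rewrite -{1}(oaddx0 a) lt_oadd2l.
by rewrite ogt0.
Qed.

Definition opow n : Ord := ord_of (tomega_pow n).

Lemma opow_gt0 n : ozero < opow n.
Proof.
rewrite lt_ord_of; apply/asboolP.
suff [j _] : exists j : branches (tomega_pow n), True.
  by exists j; apply/tleP => -[].
by elim: n => [|n [j _]]; [exists tt|exists (0%N, j)].
Qed.

(** Since omega ^ (n+1) is the supremum of the multiples of omega ^ n, some [m] has b < omega ^ n .
    (m+1); then b + omega ^ n is at most omega ^ n . (m+2), which is still below omega ^ (n+1). *)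
Lemma oadd_opow n b : b < opow n.+1 -> oadd b (opow n) < opow n.+1.
Proof.
have := opow_gt0 n; rewrite lt_ord_of => /asboolP[j _].
set x := tomega_pow n; rewrite -[b]ord_ofK oadd_ord_of !lt_ord_of => /asboolP.
have step m : tle (tadd (tmul x (tnat m)) x) (tmul x (tnat m.+1)).
  apply/tle_addP; split=> [|d]; last by exists (tt, d); apply: tle_refl.
  apply: tle_trans (tle_addr _ (branch j)) _; apply: tlt_le.
  by exists (tt, j); apply: tle_refl.
move=> [[m d] /= bmd]; apply/asboolP; exists (m.+2, j).
have bm : tle (repr b) (tmul x (tnat m.+1)) by apply: tlt_le; exists (tt, d).
apply: tle_trans (tle_add2r _ bm) (tle_trans (step _) _); exact: tle_addr.
Qed.

End OrdinalSum.


(** * Ranks of tails, and flatness of sequence frames *)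

Section TailRank.
Variable P : Type.
Implicit Types s t u : oseq P.

Lemma otail_otail s a b : otail (otail s a) b = otail s (oadd a b).
Proof. by apply: oseq_ext => c /=; rewrite oaddA. Qed.

Lemma tail_rank_ex s t b :
  b <= olen s -> t = otail s b -> exists2 c, tail_rank s t c & c <= b.
Proof.
move=> bs tb; have [|c [cs tc] c_min] :=
  @ord_least [set c | c <= olen s /\ t = otail s c]; first by exists b.
by exists c; [split=> // d ds td; apply: c_min | apply: c_min].
Qed.

(** Only an inequality holds: the same tail may already occur in [s] before [a + b], and even before
    [a]. *)
Lemma tail_rank_comp s t u a b : tail_rank s t a -> tail_rank t u b ->
  exists2 c, tail_rank s u c & c <= oadd a b.
Proof.
move=> [a_le -> _] [/= b_le -> _]; apply: tail_rank_ex; last exact: otail_otail.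
by rewrite -le_osub.
Qed.

Lemma tail_rank_diff s t u a b : tail_rank s t a -> tail_rank s u (oadd a b) ->
  tail_rank t u b.
Proof.
move=> [a_le -> _] [b_le -> b_min]; split=> [||c c_le cE].
- by rewrite /= le_osub.
- by rewrite otail_otail.
- rewrite -(le_oadd2l a); apply: b_min; last by rewrite cE otail_otail.
  by rewrite -le_osub.
Qed.

Variables (W : set (oseq P)) (W0 : W !=set0).
Implicit Types w x y : seqFrame W0.

Lemma reach_seqFrame w x : reach w x <-> exists b, tail_rank (\val w) (\val x) b.
Proof.
split=> [[->|[_ [b [_ xb _]]]]|[b xb]]; last 2 first.
- by exists b.
- have [b0|b0] := eqVneq b ozero.
    left; apply: val_inj; rewrite b0 in xb.
    exact: tail_rank_inj xb (tail_rank_refl _).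
  right; exists ozero, b; split=> //; first exact: tail_rank_refl.
  by rewrite ogt0.
by exists ozero; apply: tail_rank_refl.
Qed.

Lemma first_in_seqFrame w (A : set (seqFrame W0)) x : first_in w A x <->
  A x /\ exists2 b, tail_rank (\val w) (\val x) b &
    forall y c, A y -> tail_rank (\val w) (\val y) c -> b <= c.
Proof.
split=> [[/reach_seqFrame[b xb] Ax x_min]|[Ax [b xb x_min]]].
  split=> //; exists b => // y c Ay yc; rewrite leNgt; apply/negP => cb.
  by apply: x_min Ay; exists c, b.
split=> // [|y [c [b' [yc xb' cb']]] Ay]; first by apply/reach_seqFrame; exists b.
rewrite (tail_rank_uniq xb' xb) in cb'.
by have := lt_le_trans cb' (x_min y c Ay yc); rewrite ltxx.
Qed.

Lemma flat_seqFrame : flat (seqFrame W0).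
Proof.
move=> w x A B /first_in_seqFrame[Ax [a xa x_min]] BA y.
(* Members of [B] lie in [A], so their rank in [w] is at least the rank [a] of [x]; subtracting [a]
   gives their rank in [x]. *)
have after z e : B z -> tail_rank (\val w) (\val z) e ->
    exists2 d, e = oadd a d & tail_rank (\val x) (\val z) d.
  move=> Bz ze; have ae := x_min z e (BA _ Bz) ze.
  exists (osub e a); first by rewrite oadd_osub.
  by apply: (tail_rank_diff xa); rewrite oadd_osub.
split=> /first_in_seqFrame[By [b yb y_min]]; apply/first_in_seqFrame; split=> //.
  have [d bE yd] := after _ _ By yb; exists d => // z c Bz zc.
  have [e ze ec] := tail_rank_comp xa zc.
  by rewrite -(le_oadd2l a) -bE; apply: le_trans (y_min _ _ Bz ze) ec.
have [c yc cb] := tail_rank_comp xa yb; exists c => // z e Bz ze.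
have [d -> zd] := after _ _ Bz ze.
by apply: le_trans cb _; rewrite le_oadd2l; apply: y_min zd.
Qed.

End TailRank.

(** * Transfinite walks *)

Lemma filter_notin_sub (T : finType) (A B : {set T}) (s t : seq T) : A \subset B ->
  [seq c <- s | c \notin A] = [seq c <- t | c \notin A] ->
  [seq c <- s | c \notin B] = [seq c <- t | c \notin B].
Proof.
have sub r : A \subset B ->
    [seq c <- r | c \notin B] = [seq c <- [seq c <- r | c \notin A] | c \notin B].
  move=> /fintype.subsetP AB; rewrite -filter_predI; apply: eq_filter => c /=.
  by have [cB|//] := boolP (c \notin B); rewrite /= (contra (AB c) cB).
by move=> AB st; rewrite (sub s) // (sub t) // st.
Qed.

Section Walk.
(** In the application [X] consists of the types, [T] of the cells, and [nx] is the move that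
    Flattening provides. *)
Variables (T X : finType) (ty : X -> seq T) (hd : X -> T) (nx : X -> {set T} -> X).
Hypothesis tyE : forall x, ohead (ty x) = Some (hd x).
Hypothesis nx_hd : forall x (A : {set T}),
  has (fun c => c \notin A) (ty x) -> hd (nx x A) \notin A.
Hypothesis nx_ty : forall x (A : {set T}),
  has (fun c => c \notin A) (ty x) ->
  [seq c <- ty (nx x A) | c \notin A] = [seq c <- ty x | c \notin A].

Definition cells (S : {set X}) : {set T} := (hd @: S)%SET.

(** [u] depends on the set [S] alone, hence memorylessness. An empty [S] yields [None], so that a
    stopped walk remains stopped. *)
Definition next_state (S : {set X}) : option X :=
  if [pick u in S] is Some u then
    if has (fun c => c \notin cells S) (ty u) then Some (nx u (cells S)) else None
  else None.

Definition walk_body (x : X) (a : Ord) (rec : forall b, b < a -> option X) :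
    option X :=
  if a == ozero then Some x
  else next_state [set y | `[< forall b, b < a ->
         exists c (ca : c < a), b <= c /\ rec c ca = Some y >]].

Definition walk (x : X) : Ord -> option X :=
  Fix ord_wf (fun=> option X) (walk_body x).

(** At a successor this holds at most the preceding state; at a limit, the states that recur
    unboundedly below it. *)
Definition cofinal_states (x : X) (a : Ord) : {set X} :=
  [set y | `[< forall b, b < a ->
                 exists c, [/\ b <= c, c < a & walk x c = Some y] >]].

Lemma cofinal_statesP x a y : reflect
  (forall b, b < a -> exists c, [/\ b <= c, c < a & walk x c = Some y])
  (y \in cofinal_states x a).
Proof. by rewrite inE; apply: asboolP. Qed.

Lemma walkE x a : walk x a =
  if a == ozero then Some x else next_state (cofinal_states x a).
Proof.
rewrite {1}/walk Fix_eq /walk_body => [|b f g fg].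
  case: eqP => // _; congr next_state; apply/finset.setP => y; rewrite !inE.
  apply: asbool_equiv_eq; split=> h b /h.
    by move=> [c [ca [bc yc]]]; exists c.
  by move=> [c [bc ca yc]]; exists c, ca.
case: eqP => // _; congr next_state; apply/finset.setP => y; rewrite !inE.
by apply: asbool_equiv_eq; split=> h c /h [d [db [cd yd]]]; exists d, db;
  rewrite (fg, =^~ fg).
Qed.

Lemma walk0 x : walk x ozero = Some x.
Proof. by rewrite walkE eqxx. Qed.

(* The state at [a] only depends on how the walk behaves just below [a], so the
   walk is memoryless. *)
Lemma walk_oadd x y a b : walk x a = Some y -> walk x (oadd a b) = walk y b.
Proof.
move=> xa; elim/(well_founded_ind ord_wf): b => b IH.
have [->|b0] := eqVneq b ozero; first by rewrite oaddx0 walk0.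
rewrite !walkE (negbTE b0) (negbTE (oadd_neq0 a b0)); congr next_state.
apply/finset.setP => z; apply/cofinal_statesP/cofinal_statesP => h c.
  rewrite -(lt_oadd2l a) => /h[d [cd db zd]].
  have dE := oadd_osub (le_trans (le_oaddr _ _) cd); rewrite -dE in cd db zd.
  rewrite le_oadd2l in cd; rewrite lt_oadd2l in db.
  by exists (osub d a); split=> //; rewrite -IH.
move=> cab; have [ac|ca] := leP a c.
  rewrite -(oadd_osub ac) lt_oadd2l in cab; have [d [cd db zd]] := h _ cab.
  exists (oadd a d); rewrite lt_oadd2l IH //; split=> //.
  by rewrite -(oadd_osub ac) le_oadd2l.
(* When [c] lies below [a], every [a + d] is beyond [c], so any occurrence of [z] will do. *)
have [|d [_ db zd]] := h ozero; first by rewrite ogt0.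
exists (oadd a d); rewrite lt_oadd2l IH //; split=> //.
exact: le_trans (ltW ca) (le_oaddr _ _).
Qed.

Lemma walk_stop x a b : walk x a = None -> a <= b -> walk x b = None.
Proof.
move=> xa; elim/(well_founded_ind ord_wf): b => b IH.
rewrite le_eqVlt => /predU1P[<- //|ab].
have b0 : b != ozero.
  by apply: contraTneq ab => ->; rewrite -leNgt ole0x.
rewrite walkE (negbTE b0) /next_state; case: pickP => // u.
by move=> /cofinal_statesP/(_ a ab)[c [ac cb]]; rewrite IH.
Qed.

Lemma walk_defined x a b : walk x a -> b <= a -> walk x b.
Proof.
move=> xa ba; case E : (walk x b) => //.
by rewrite (walk_stop E ba) in xa.
Qed.

(** * Which cells a walk visits, and when it stops *)

Definition visited (x : X) (a : Ord) : {set T} :=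
  [set c | `[< exists b y, [/\ b < a, walk x b = Some y & hd y = c] >]].

Lemma visitedP x a c : reflect
  (exists b y, [/\ b < a, walk x b = Some y & hd y = c]) (c \in visited x a).
Proof. by rewrite inE; apply: asboolP. Qed.

Lemma visitedS x a b : a <= b -> visited x a \subset visited x b.
Proof.
move=> ab; apply/fintype.subsetP => c /visitedP[d [y [da yd yc]]]; apply/visitedP.
by exists d, y; split=> //; apply: lt_le_trans ab.
Qed.

Lemma cells_visited x a : a != ozero ->
  cells (cofinal_states x a) \subset visited x a.
Proof.
move=> a0; apply/fintype.subsetP => _ /imsetP[y /cofinal_statesP h ->].
have [|c [_ ca yc]] := h ozero; first by rewrite ogt0.
by apply/visitedP; exists c, y.
Qed.

(** A move alters the list of [u] only inside the cofinal cells, which have been visited, and [u]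
    itself was reached earlier, so induction applies to it. *)
Lemma walk_invariant x a y : walk x a = Some y ->
  [seq c <- ty y | c \notin visited x a] = [seq c <- ty x | c \notin visited x a].
Proof.
elim/(well_founded_ind ord_wf): a y => a IH y.
rewrite walkE; have [_ [->//]|a0] := eqVneq a ozero.
rewrite /next_state; case: pickP => // u uS; case: ifP => // hasu [<-].
rewrite (filter_notin_sub (cells_visited x a0) (nx_ty hasu)).
move: uS => /cofinal_statesP h.
have [|c [_ ca uc]] := h ozero; first by rewrite ogt0.
exact: filter_notin_sub (visitedS x (ltW ca)) (IH c ca u uc).
Qed.

(** Each state that is not cofinal ceases to occur from some stage on; as there are finitely many
    states, the maximum of these stages is still below [a]. *)
Lemma cofinal_threshold x a : a != ozero -> exists2 b, b < a &
  forall y c, b <= c -> c < a -> walk x c = Some y -> y \in cofinal_states x a.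
Proof.
move=> a0; have /choice[f fP] : forall y, exists b, b < a /\
    (y \notin cofinal_states x a ->
     forall c, b <= c -> c < a -> walk x c <> Some y).
  move=> y; have [yS|/cofinal_statesP] := boolP (y \in cofinal_states x a).
    by exists ozero; rewrite ogt0.
  move=> /existsNP[b /not_implyP[ba nb]]; exists b; split=> // _ c bc ca yc.
  by apply: nb; exists c.
exists (\big[Order.max/ozero]_y f y).
  apply/bigmax_ltP; split; first by rewrite ogt0.
  by move=> y _; case: (fP y).
move=> y c bc ca yc; apply: contrapT => /negP nyS.
by case: (fP y) => _ /(_ nyS c (le_trans (le_bigmax _ _ _) bc) ca).
Qed.

(** Past a threshold [b] below omega ^ (n+1) all states met are cofinal. The walk restarted at [b]
    reaches its own stage omega ^ n before then, so by induction there are at least n + 1 cofinal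
    cells. The state at omega ^ (n+1) starts outside them and adds one more. *)
Lemma walk_card x n y : walk x (opow n) = Some y ->
  (n < #|hd y |: visited x (opow n)|)%N.
Proof.
elim: n x y => [|n IH] x y.
  by rewrite card_gt0 => _; apply/set0Pn; exists (hd y); rewrite !inE eqxx.
move=> xn; have n0 : opow n.+1 != ozero by rewrite gt_eqF // opow_gt0.
have [b bn bS] := cofinal_threshold x n0.
have bnn := oadd_opow bn.
have [z xb] : exists z, walk x b = Some z.
  have : walk x b by apply: walk_defined (ltW bn); rewrite xn.
  by case: (walk x b) => // z; exists z.
have [u zu] : exists u, walk z (opow n) = Some u.
  rewrite -(walk_oadd _ xb).
  have : walk x (oadd b (opow n)) by apply: walk_defined (ltW bnn); rewrite xn.
  by case: (walk x _) => // u; exists u.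
have sub : hd u |: visited z (opow n) \subset cells (cofinal_states x (opow n.+1)).
  apply/fintype.subsetP => c.
  rewrite in_setU1 => /predU1P[->|/visitedP[d [v [dn zv <-]]]].
    apply: imset_f; apply: bS bnn _; first exact: le_oaddr.
    by rewrite (walk_oadd _ xb).
  have dn' : oadd b d < opow n.+1 by apply: lt_trans bnn; rewrite lt_oadd2l.
  apply: imset_f; apply: bS dn' _; first exact: le_oaddr.
  by rewrite (walk_oadd _ xb).
have nhd : hd y \notin cells (cofinal_states x (opow n.+1)).
  move: xn; rewrite walkE (negbTE n0) /next_state.
  by case: pickP => // v _; case: ifP => // hasv [<-]; apply: nx_hd.
apply: leq_ltn_trans (IH _ _ zu) _; apply: leq_ltn_trans (subset_leq_card sub) _.
apply: (@leq_trans #|hd y |: cells (cofinal_states x (opow n.+1))|%SET).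
  by rewrite cardsU1 nhd.
exact/subset_leq_card/finset.setUS/cells_visited.
Qed.

(** A walk still running at omega ^ |T| would have met more than |T| cells. The exponent |T| + 1
    then gives a strict bound below omega ^ omega. *)
Lemma walk_stops x : exists a, [/\ walk x a = None, a < omega_omega &
  forall b, b < a -> walk x b].
Proof.
have stop : walk x (opow #|T|) = None.
  case E : (walk x _) => [y|//].
  by have := walk_card E; rewrite ltnNge max_card.
have [|a xa a_min] := @ord_least [set a | walk x a = None].
  by exists (opow #|T|).
exists a; split=> // [|b ba].
  apply/lt_omega_omega; exists #|T|.+1; apply: le_lt_trans (a_min _ stop) _.
  by have := oadd_opow (opow_gt0 #|T|.+1); rewrite oadd0x.
by case E : (walk x b) => [//|]; have := a_min b E; rewrite leNgt ba.
Qed.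

(** The threshold shows that some state is cofinal below [a], so the walk can only have stopped
    because the cofinal cells exhaust the list of the picked [u]. That list agrees with the list of
    [x] outside the visited cells, so nothing of the latter is left over. *)
Lemma visited_all x a : walk x a = None -> (forall b, b < a -> walk x b) ->
  {subset ty x <= visited x a}.
Proof.
move=> xa a_min; have a0 : a != ozero.
  by apply: contra_eqN xa => /eqP ->; rewrite walk0.
have [b ba bS] := cofinal_threshold x a0.
have [v vS] : exists v, v \in cofinal_states x a.
  have := a_min b ba; case E : (walk x b) => [v|//] _; exists v.
  exact: bS (lexx b) ba E.
move: xa; rewrite walkE (negbTE a0) /next_state.
case: pickP => [u uS|/(_ v)]; last by rewrite vS.
case: ifP => // /hasPn hasu _ c cx.
have [//|cV] := boolP (c \in visited x a).
move: uS => /cofinal_statesP/(_ _ ba)[d [_ da ud]].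
have := filter_notin_sub (visitedS x (ltW da)) (walk_invariant ud).
have -> : [seq c <- ty u | c \notin visited x a] = [::].
  apply/eqP; rewrite -[_ == _]negbK -has_filter; apply/hasPn => e /hasu.
  rewrite !negbK; apply: fintype.subsetP; exact: cells_visited.
move=> /(congr1 (fun s => c \in s)).
by rewrite mem_filter cV cx.
Qed.

(** No [p]-cell is visited before [a], so by the invariant the lists of [x] and [y] have the same
    [p]-cells in the same order, and the list of [y] begins with one. *)
Lemma walk_first x a y (p : pred T) : walk x a = Some y -> p (hd y) ->
  (forall b z, b < a -> walk x b = Some z -> ~~ p (hd z)) ->
  ohead [seq c <- ty x | p c] = Some (hd y).
Proof.
move=> xa py p_min.
have npV c : p c -> c \notin visited x a.
  move=> pc; apply/negP => /visitedP[b [z [ba xb zc]]].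
  by move: (p_min b z ba xb); rewrite zc pc.
have filterE s :
    [seq c <- s | p c] = [seq c <- [seq c <- s | c \notin visited x a] | p c].
  rewrite -filter_predI; apply: eq_filter => c /=.
  by case E : (p c) => //=; rewrite npV.
rewrite filterE -(walk_invariant xa) -filterE.
by have := tyE y; case: (ty y) => //= c s [->]; rewrite py.
Qed.

(** * The sequence frame made of walks *)

Fact walk_oseq_dom x : exists s : oseq X, oval s = walk x.
Proof.
have [a [xa _ a_def]] := walk_stops x.
have dom b : isSome (walk x b) = (b < a).
  by case: (ltP b a) => [/a_def//|/(walk_stop xa) ->].
by exists (OSeq dom).
Qed.

Definition walk_seq x : oseq X := sval (cid (walk_oseq_dom x)).

Lemma walk_seqE x : oval (walk_seq x) = walk x.
Proof. exact: svalP (cid (walk_oseq_dom x)). Qed.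

Lemma walk_seq_inj : injective walk_seq.
Proof.
move=> x y /(congr1 (fun s => oval s ozero)).
by rewrite !walk_seqE !walk0 => -[].
Qed.

Lemma lt_walk_seq x a : (a < olen (walk_seq x)) = isSome (walk x a).
Proof. by rewrite -oval_dom walk_seqE. Qed.

Lemma walk_seq_lt x : olen (walk_seq x) < omega_omega.
Proof.
have [a [xa aww _]] := walk_stops x; apply: le_lt_trans aww.
by rewrite leNgt lt_walk_seq xa.
Qed.

Lemma walk_seq_tail x a y : walk x a = Some y -> otail (walk_seq x) a = walk_seq y.
Proof.
by move=> xa; apply: oseq_ext => c /=; rewrite !walk_seqE (walk_oadd _ xa).
Qed.

Lemma walk_seq_tailP x a y :
  walk_seq y = otail (walk_seq x) a <-> walk x a = Some y.
Proof.
split=> [/(congr1 (fun s => oval s ozero))|/walk_seq_tail //].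
by rewrite /= !walk_seqE walk0 oaddx0.
Qed.

Definition walk_set : set (oseq X) := range walk_seq.

Variable x0 : X.

Fact walk_set_nonempty : walk_set !=set0.
Proof. by exists (walk_seq x0), x0. Qed.

Definition walkFrame : orderFrame := seqFrame walk_set_nonempty.

Definition walk_world (x : X) : walkFrame :=
  exist _ (walk_seq x) (mem_set (imageT walk_seq x)).

Lemma walk_worldP (w : walkFrame) : exists x, w = walk_world x.
Proof.
by case: w => s sW; have [x _ xs] := set_mem sW; exists x; apply: val_inj.
Qed.

Lemma walk_set_finite : finite_set walk_set.
Proof. exact/finite_image/finite_finset. Qed.

Lemma walk_set_tail_closed : tail_closed walk_set.
Proof.
move=> _ b [x _ <-] _ tail_gt0.
have : walk x b.
  rewrite -lt_walk_seq -{1}(oaddx0 b) -olt_osub.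
  by rewrite ogt0.
by case E : (walk x b) => [y|//] _; exists y => //; rewrite (walk_seq_tail E).
Qed.

Lemma tail_rank_walk_seq x y a : tail_rank (walk_seq x) (walk_seq y) a <->
  walk x a = Some y /\ forall b, walk x b = Some y -> a <= b.
Proof.
split=> [[_ /walk_seq_tailP xa a_min]|[xa a_min]].
  split=> // b xb; apply: a_min; last exact/walk_seq_tailP.
  by apply: ltW; rewrite lt_walk_seq xb.
split=> [||b _ /walk_seq_tailP]; last exact: a_min.
  by apply: ltW; rewrite lt_walk_seq xa.
exact/walk_seq_tailP.
Qed.

(** The least stage [e] whose head satisfies [a] is the rank of the first [q]-tail, and [walk_first]
    identifies its head with the first [a]-cell of the list. If there is no such stage,
    [visited_all] shows that the list has no [a]-cell either. *)
Lemma denot_walk_cond (V : nat -> walkFrame -> bool) q r (a b : pred T) x :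
  (forall y, denot V q (walk_world y) <-> a (hd y)) ->
  (forall y, denot V r (walk_world y) <-> b (hd y)) ->
  denot V (Cond q r) (walk_world x) <->
  (if ohead [seq c <- ty x | a c] is Some c then b c else true).
Proof.
move=> qa rb; rewrite denot_cond.
have [[d [y [xd ay]]]|none] := pselect (exists d y, walk x d = Some y /\ a (hd y)).
  have [|e [z [xe az]] e_min] :=
      @ord_least [set d | exists y, walk x d = Some y /\ a (hd y)].
    by exists d, y.
  have -> : ohead [seq c <- ty x | a c] = Some (hd z).
    apply: walk_first xe az _ => f u fe xf; apply/negP => au.
    by have := e_min f (ex_intro _ u (conj xf au)); rewrite leNgt fe.
  have zfirst : first_in (walk_world x) (denot V q) (walk_world z).
    apply/first_in_seqFrame; split; first exact/qa.
    exists e => [|w f].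
      by apply/tail_rank_walk_seq; split=> // f xf; apply: e_min; exists z.
    have [u ->] := walk_worldP w; move=> /qa au /tail_rank_walk_seq[xf _].
    by apply: e_min; exists u.
  split=> [/(_ _ zfirst)/rb //|bz y' /(first_in_uniq zfirst) <-]; exact/rb.
have -> : [seq c <- ty x | a c] = [::].
  apply/eqP; rewrite -[_ == _]negbK -has_filter; apply/hasPn => c.
  have [f [xf _ f_def]] := walk_stops x.
  move=> /(visited_all xf f_def)/visitedP[g [y [_ xg <-]]].
  by apply/negP => ay; apply: none; exists g, y.
split=> // _ w /first_in_seqFrame[]; have [y ->] := walk_worldP w.
move=> /qa ay [f /tail_rank_walk_seq[xf _] _]; case: none; by exists f, y.
Qed.

End Walk.

(** * Maximal consistent sets *)

HB.instance Definition _ := gen_eqMixin form.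

Section MaximalConsistent.
Implicit Types (p q r : form) (w u X : set form).

Definition pimpl (a b : pform) : pform := PNeg (PConj a (PNeg b)).

Lemma C2F_taut (a : pform) (s : seq form) :
  tautology a -> C2F (psubst (nth (Atom 0) s) a).
Proof. by move=> ta; apply/C2F_C2/C2_PC. Qed.

(** Closure under Detachment only: Normality preserves theoremhood, not membership in a theory. *)
Definition theory X : Prop :=
  C2F `<=` X /\ forall p q, X (Impl p q) -> X p -> X q.

Definition mcs w : Prop := theory w /\ forall p, w (Neg p) <-> ~ w p.

Lemma theoryK X p q : theory X -> X q -> X (Impl p q).
Proof.
move=> [thX mpX]; apply: mpX; apply: thX.
apply: (@C2F_taut (pimpl (PVar 0) (pimpl (PVar 1) (PVar 0))) [:: q; p]).
by move=> v /=; case: (v 0%N); case: (v 1%N).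
Qed.

Lemma theory_extend X p : theory X -> theory [set q | X (Impl p q)].
Proof.
move=> thX; split=> [q /thX.1|q r]; first exact: theoryK.
move=> /= pqr pq; apply: thX.2 pq; apply: thX.2 pqr; apply: thX.1.
apply: (@C2F_taut (pimpl (pimpl (PVar 0) (pimpl (PVar 1) (PVar 2)))
  (pimpl (pimpl (PVar 0) (PVar 1)) (pimpl (PVar 0) (PVar 2)))) [:: p; q; r]).
by move=> v /=; case: (v 0%N); case: (v 1%N); case: (v 2%N).
Qed.

Lemma theory_cases X p r : theory X -> X (Impl p r) -> X (Impl (Neg p) r) -> X r.
Proof.
move=> thX pr; apply: thX.2; apply: thX.2 pr; apply: thX.1.
apply: (@C2F_taut (pimpl (pimpl (PVar 0) (PVar 1))
  (pimpl (pimpl (PNeg (PVar 0)) (PVar 1)) (PVar 1))) [:: p; r]).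
by move=> v /=; case: (v 0%N); case: (v 1%N).
Qed.

Lemma theory_explosion X p q : theory X -> X (Neg p) -> X p -> X q.
Proof.
move=> thX np; apply: thX.2; apply: thX.2 np; apply: thX.1.
apply: (@C2F_taut (pimpl (PNeg (PVar 0)) (pimpl (PVar 0) (PVar 1))) [:: p; q]).
by move=> v /=; case: (v 0%N); case: (v 1%N).
Qed.

(** A maximal theory [M] omitting [phi] contains [p ⊃ phi] for every [p] outside it; were [p] and
    its negation both outside, [phi] would follow by cases. *)
Lemma mcs_avoiding phi : ~ C2F phi -> exists2 w, mcs w & ~ w phi.
Proof.
move=> nphi; pose good X := X = set0 \/ (theory X /\ ~ X phi).
have thC : theory C2F by split=> // p q; apply: C2F_detachment.
have [|M [Mgood M_max]] := @Zorn_bigcup form good.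
  move=> F Fgood Ftot.
  have [[X FX [q Xq]]|none] := pselect (exists2 X, F X & X !=set0).
    have th Y q' : F Y -> Y q' -> theory Y /\ ~ Y phi.
      by move=> /Fgood[-> //|//].
    right; split; last by move=> [Y FY Yphi]; case: (th Y phi FY Yphi).
    split=> [r Cr|r s [Y FY Yrs] [Z FZ Zr]].
      by exists X => //; apply: (th X q FX Xq).1.1.
    have [YZ|ZY] := Ftot _ _ FY FZ.
      by exists Z => //; apply: (th Z r FZ Zr).1.2 Zr; apply: YZ.
    by exists Y => //; apply: (th Y _ FY Yrs).1.2 Yrs _; apply: ZY.
  left; rewrite -subset0 => q [X FX Xq]; apply: none; exists X => //; by exists q.
have [M0|[thM nM]] := Mgood.
  case: (M_max C2F); last by right.
  rewrite M0; split; first exact: sub0set.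
  by move=> /(_ (Cond phi phi)); apply; apply/C2F_C2/C2_identity.
have ext p : ~ M p -> M (Impl p phi).
  move=> np; apply: contrapT => npphi.
  apply: (M_max [set q | M (Impl p q)]); last first.
    by right; split=> //; apply: theory_extend.
  split=> [q|/(_ p)]; first exact: theoryK.
  move=> /= h; apply: np; apply: h; apply: thM.1.
  apply: (@C2F_taut (pimpl (PVar 0) (PVar 0)) [:: p]).
  by move=> v /=; case: (v 0%N).
exists M => //; split=> // p; split=> [np Mp|np].
  exact: nM (theory_explosion _ thM np Mp).
apply: contrapT => /ext; apply/contra_not: nM.
by apply: theory_cases => //; apply: ext.
Qed.

Lemma C2F_mcs p : (forall w, mcs w -> w p) -> C2F p.
Proof. by move=> h; apply: contrapT => /mcs_avoiding[w /h]. Qed.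

Lemma mcs_conj w p q : mcs w -> w (Conj p q) <-> (w p /\ w q).
Proof.
move=> [thw _]; split=> [pq|[wp wq]].
  split; apply: thw.2 pq; apply: thw.1.
    apply: (@C2F_taut (pimpl (PConj (PVar 0) (PVar 1)) (PVar 0)) [:: p; q]).
    by move=> v /=; case: (v 0%N); case: (v 1%N).
  apply: (@C2F_taut (pimpl (PConj (PVar 0) (PVar 1)) (PVar 1)) [:: p; q]).
  by move=> v /=; case: (v 0%N); case: (v 1%N).
apply: thw.2 wq; apply: thw.2 wp; apply: thw.1.
apply: (@C2F_taut
  (pimpl (PVar 0) (pimpl (PVar 1) (PConj (PVar 0) (PVar 1)))) [:: p; q]).
by move=> v /=; case: (v 0%N); case: (v 1%N).
Qed.

Lemma mcs_neg w p : mcs w -> w (Neg p) <-> ~ w p.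
Proof. by case. Qed.

Lemma mcs_impl w p q : mcs w -> w (Impl p q) <-> (w p -> w q).
Proof.
move=> mw; rewrite /Impl mcs_neg // mcs_conj // mcs_neg //; split=> [h wp|h [wp]].
  by apply: contrapT => nq; apply: h.
by apply; apply: h.
Qed.

Lemma mcs_disj w p q : mcs w -> w (Disj p q) <-> (w p \/ w q).
Proof.
move=> mw; rewrite /Disj mcs_neg // mcs_conj // !mcs_neg //.
split=> [h|[wp|wq] []//].
by have [wp|np] := pselect (w p); [left|right; apply: contrapT => nq; apply: h].
Qed.

Lemma mcs_thm w p : mcs w -> C2F p -> w p.
Proof. by move=> [[thw _] _]; apply: thw. Qed.

(** By [C2F_mcs] a premise about all maximal consistent sets amounts to provability, so Normality
    can be applied without writing derivations. *)
Lemma mcs_normality w p q r s : mcs w -> w (Cond s p) -> w (Cond s q) ->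
  (forall u, mcs u -> u p -> u q -> u r) -> w (Cond s r).
Proof.
move=> mw sp sq pqr; have : w (Impl (Conj (Cond s p) (Cond s q)) (Cond s r)).
  apply: mcs_thm mw _; apply: C2F_normality; apply: C2F_mcs => u mu.
  by rewrite mcs_impl // mcs_conj // => -[]; apply: pqr.
by rewrite mcs_impl // mcs_conj //; apply.
Qed.

Lemma mcs_identity w p : mcs w -> w (Cond p p).
Proof. by move=> mw; apply: mcs_thm mw _; apply/C2F_C2/C2_identity. Qed.

Lemma mcs_strict w p q : mcs w -> (forall u, mcs u -> u p -> u q) -> w (Cond p q).
Proof.
move=> mw pq; have pp := mcs_identity p mw.
by apply: (mcs_normality mw pp pp) => u mu up _; apply: pq.
Qed.

Lemma mcs_recip w p q r : mcs w -> w (Cond p q) -> w (Cond q p) ->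
  w (Cond p r) <-> w (Cond q r).
Proof.
move=> mw pq qp.
have h a b c : w (Cond a b) -> w (Cond b a) -> w (Cond a c) -> w (Cond b c).
  move=> ab ba ac.
  have : w (Impl (Conj (Conj (Cond a b) (Cond b a)) (Cond a c)) (Cond b c)).
    by apply: mcs_thm mw _; apply/C2F_C2/C2_reciprocity.
  by rewrite mcs_impl // !mcs_conj //; apply.
by split; apply: h.
Qed.

Lemma mcs_equiv w p q r : mcs w -> (forall u, mcs u -> u p <-> u q) ->
  w (Cond p r) <-> w (Cond q r).
Proof.
move=> mw pq; apply: mcs_recip => //; apply: mcs_strict => // u mu;
  by case: (pq u mu).
Qed.

Lemma mcs_impossible w p q : mcs w -> w (Cond p (Neg p)) -> w (Cond p q).
Proof.
move=> mw pnp; apply: mcs_normality mw pnp (mcs_identity p mw) _ => u mu.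
by rewrite mcs_neg.
Qed.

Definition shift w p : set form := [set q | w (Cond p q)].

(** Normality makes the conditioned set a theory, CEM makes it complete, and the hypothesis that [p]
    is possible makes it consistent. *)
Lemma mcs_shift w p : mcs w -> ~ w (Cond p (Neg p)) -> mcs (shift w p).
Proof.
move=> mw np; split; first split.
- by move=> q Cq; apply: mcs_strict => // u mu _; apply: mcs_thm.
- move=> q r /= pqr pq; apply: mcs_normality mw pqr pq _ => u mu.
  by rewrite mcs_impl.
move=> q; split=> /= [pnq pq|].
  by apply: np; apply: mcs_normality mw pnq pq _ => u mu; rewrite mcs_neg.
have : w (Disj (Cond p q) (Cond p (Neg q))).
  by apply: mcs_thm mw _; apply/C2F_C2/C2_CEM.
by rewrite mcs_disj // => -[].
Qed.

Lemma mcs_MP w p q : mcs w -> w p -> w (Cond p q) -> w q.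
Proof.
move=> mw wp; have : w (Impl (Cond p q) (Impl p q)).
  by apply: mcs_thm mw _; apply/C2F_C2/C2_MP.
by rewrite !mcs_impl // => h /h; apply.
Qed.

Lemma mcs_shift_self w p : mcs w -> w p -> ~ w (Cond p (Neg p)) /\ shift w p = w.
Proof.
move=> mw wp; have np : ~ w (Cond p (Neg p)).
  by move=> /(mcs_MP mw wp); rewrite mcs_neg.
split=> //; apply/seteqP; split=> q; first exact: mcs_MP.
move=> wq; apply: contrapT.
rewrite -(mcs_neg _ (mcs_shift mw np)) /= => /(mcs_MP mw wp).
by rewrite mcs_neg.
Qed.

Lemma mcs_flattening w p q r : mcs w ->
  w (Cond p (Cond (Conj p q) r)) <-> w (Cond (Conj p q) r).
Proof.
move=> mw; have : w (Iff (Cond p (Cond (Conj p q) r)) (Cond (Conj p q) r)).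
  by apply: mcs_thm mw _; apply: C2F_flattening.
by rewrite mcs_conj // !mcs_impl // => -[].
Qed.

End MaximalConsistent.

(** * Choice functions on finite sets as priority lists *)

(** The constantly true predicate recovers the head; adding the condition [z != x] to a predicate
    passes to the tails. *)
Lemma ohead_filter_inj (T : eqType) (s t : seq T) : uniq s -> uniq t ->
  (forall a : pred T, ohead [seq x <- s | a x] = ohead [seq x <- t | a x]) -> s = t.
Proof.
elim: s t => [|x s IH] [|y t] //=; first by move=> _ _ /(_ predT).
  by move=> _ _ /(_ predT).
move=> /andP[xs us] /andP[yt ut] h; have := h predT => /= -[xy].
rewrite -{y}xy in yt h *; congr cons; apply: IH => // a.
have := h (fun z => (z != x) && a z); rewrite /= eqxx /=.
by congr (ohead _ = ohead _); apply: eq_in_filter => z zs;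
  rewrite (memPn _ z zs) // ?xs ?yt.
Qed.

(** List the choice [x] from [A] first, then continue with [A] without [x]: a subset containing [x]
    also chooses [x], and any other subset lies in the remainder. The list ends once nothing is
    chosen. *)
Lemma rational_choice (T : finType) (f : {set T} -> option T) :
  (forall A x, f A = Some x -> x \in A) ->
  (forall A B : {set T}, B \subset A ->
     (if f A is Some x then x \in B else true) -> f B = f A) ->
  exists2 t, uniq t & forall A, f A = ohead [seq x <- t | x \in A].
Proof.
move=> f_in f_sub; suff main n (A : {set T}) : (#|A| <= n)%N -> exists t,
    [/\ uniq t, {subset t <= A} &
        forall B : {set T}, B \subset A -> f B = ohead [seq x <- t | x \in B]].
  have [t [ut _ tE]] := main _ [set: T]%SET (leqnn _).
  by exists t => // A; apply: tE; apply: finset.subsetT.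
elim: n A => [|n IH] A An; case fA : (f A) => [x|].
- by move: An (f_in _ _ fA); rewrite leqn0 cards_eq0 => /eqP ->; rewrite inE.
- by exists [::]; split=> // B BA; rewrite (f_sub A) // fA.
- have xA := f_in _ _ fA.
  have [|t [ut tA tE]] := IH (A :\ x)%SET.
    by move: An; rewrite (cardsD1 x) xA.
  exists (x :: t); split=> /=.
  + by rewrite ut andbT; apply/negP => /tA; rewrite !inE eqxx.
  + by move=> y; rewrite inE => /predU1P[->//|/tA]; rewrite inE => /andP[].
  + move=> B BA; case: ifP => xB; first by rewrite (f_sub A) // fA.
    by apply: tE; rewrite subsetD1 BA xB.
- by exists [::]; split=> // B BA; rewrite (f_sub A) // fA.
Qed.

(** * Cells and types of maximal consistent sets *)

Section Types.
Variable L : seq form.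
Implicit Types (w u : set form).

Definition cell w : (size L).-tuple bool :=
  map_tuple (fun q => `[< w q >]) (in_tuple L).
Local Notation T := ((size L).-tuple bool).
Implicit Types (A B : {set T}) (t : seq T).

Definition holds (c : T) (q : form) : bool := nth false c (index q L).

Lemma holds_cell w q : q \in L -> holds (cell w) q = `[< w q >].
Proof.
by move=> qL; rewrite /holds /= (nth_map q) ?index_mem // nth_index.
Qed.

(** Case split on the first sentence of the list, as in a disjunctive normal form. This lets sets of
    cells serve as antecedents. *)
Lemma definable (l : seq form) (a : pred bitseq) :
  exists p, forall u, mcs u -> u p <-> a [seq `[< u q >] | q <- l].
Proof.
elim: l a => [|q l IH] a /=.
  pose top := Impl (Atom 0) (Atom 0).
  exists (if a [::] then top else Neg top) => u mu.
  have uT : u top by apply/mcs_impl.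
  by case: (a [::]); split=> // /mcs_neg-/(_ mu).
have [p1 h1] := IH (fun s => a (true :: s)).
have [p0 h0] := IH (fun s => a (false :: s)).
exists (Disj (Conj q p1) (Conj (Neg q) p0)) => u mu.
rewrite mcs_disj // !mcs_conj // mcs_neg // h1 // h0 //.
by case: asboolP => uq; split=> [[[]|[]]//|?]; [left|right].
Qed.

Lemma hat_exists : exists hat : {set T} -> form,
  forall A u, mcs u -> u (hat A) <-> cell u \in A.
Proof.
suff /choice[hat hatE] :
    forall A, exists p, forall u, mcs u -> u p <-> cell u \in A.
  by exists hat.
move=> A.
have [p hp] := definable L (fun s => s \in [seq val c | c <- enum A]).
exists p => u mu; rewrite hp //.
by rewrite -[X in X \in _]/(val (cell u)) mem_map ?mem_enum //; apply: val_inj.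
Qed.

Definition hat : {set T} -> form := sval (cid hat_exists).

Lemma hatP A u : mcs u -> u (hat A) <-> cell u \in A.
Proof. exact: (svalP (cid hat_exists)). Qed.

Definition select w A : option T :=
  if `[< w (Cond (hat A) (Neg (hat A))) >] then None
  else Some (cell (shift w (hat A))).

Definition has_type w t : Prop :=
  uniq t /\ forall A, select w A = ohead [seq c <- t | c \in A].

Lemma select_in w A c : mcs w -> select w A = Some c -> c \in A.
Proof.
rewrite /select => mw; case: asboolP => // np [<-]; apply/hatP.
  exact: mcs_shift.
exact: mcs_identity.
Qed.

Lemma select_eq w w' A B :
  (forall r, w (Cond (hat A) r) <-> w' (Cond (hat B) r)) ->
  (w (Cond (hat A) (Neg (hat A))) <-> w' (Cond (hat B) (Neg (hat B)))) ->
  select w A = select w' B.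
Proof.
move=> h e; rewrite /select (asbool_equiv_eq e).
case: ifP => // _; congr (Some _); congr cell.
by apply/seteqP; split=> r /h.
Qed.

(** If the cell selected from [A] lies in [B], or [A] is impossible, then [hat A] conditionally
    implies [hat B]; the converse conditional is strict, and Reciprocity makes the two antecedents
    interchangeable. *)
Lemma select_sub w A B : mcs w -> B \subset A ->
  (if select w A is Some c then c \in B else true) -> select w B = select w A.
Proof.
move=> mw BA h.
have AB : w (Cond (hat A) (hat B)).
  move: h; rewrite /select; case: asboolP => [imp _|np cB].
    exact: mcs_impossible.
  exact: ((hatP B (mcs_shift mw np)).2 cB).
have BA' : w (Cond (hat B) (hat A)).
  apply: mcs_strict => // u mu; rewrite !hatP //.
  exact: fintype.subsetP.
have eq r := mcs_recip r mw BA' AB.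
apply: select_eq => //; rewrite eq; split=> imp; last exact: mcs_impossible.
by apply: mcs_normality mw imp AB _ => u mu; rewrite mcs_neg.
Qed.

Lemma has_type_ex w : mcs w -> exists t, has_type w t.
Proof.
move=> mw; have [t ut tE] := rational_choice (fun A c => @select_in w A c mw)
  (fun A B => @select_sub w A B mw).
by exists t.
Qed.

Lemma has_type_head w t : mcs w -> has_type w t -> ohead t = Some (cell w).
Proof.
move=> mw [_ /(_ [set: T]%SET)]; rewrite (eq_filter (a2 := predT)); last first.
  by move=> c; rewrite inE.
rewrite filter_predT => <-; have wT : w (hat [set: T]%SET) by rewrite hatP // inE.
have [np shiftE] := mcs_shift_self mw wT.
by rewrite /select; case: asboolP => // _; rewrite shiftE.
Qed.

Lemma has_type_cond w t q r : mcs w -> has_type w t -> q \in L -> r \in L ->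
  w (Cond q r) <->
  (if ohead [seq c <- t | holds c q] is Some c then holds c r else true).
Proof.
move=> mw [_ tE] qL rL; pose A := [set c : T | holds c q]%SET.
have qA u : mcs u -> u q <-> u (hat A).
  by move=> mu; rewrite hatP // inE holds_cell //; split=> /asboolP.
rewrite (mcs_equiv _ mw qA).
rewrite (eq_filter (a2 := fun c => c \in A)); last by move=> c; rewrite inE.
rewrite -tE /select; case: asboolP => imp.
  by split=> // _; apply: mcs_impossible.
by rewrite holds_cell //; split=> /asboolP.
Qed.

(** Condition [w] on the complement of [A], which is possible because [t] meets it. For [B] inside
    the complement, [hat B] is equivalent to its conjunction with the antecedent, so by Flattening
    [w] and [w'] select alike from [B]; these selections determine the filtered lists. *)
Lemma has_type_flat w t A : mcs w -> has_type w t ->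
  has (fun c => c \notin A) t -> exists w' t',
  [/\ mcs w', has_type w' t', cell w' \notin A &
      [seq c <- t' | c \notin A] = [seq c <- t | c \notin A]].
Proof.
move=> mw [ut tE] tA; have := tE (~: A)%SET.
rewrite (eq_filter (a2 := fun c => c \notin A)); last by move=> c; rewrite inE.
have [np|imp] :=
  pselect (~ w (Cond (hat (~: A)) (Neg (hat (~: A)))%SET)); last first.
  rewrite /select asboolT; last exact: contrapT.
  by move: tA; rewrite has_filter; case: [seq c <- t | c \notin A].
move=> _; pose w' := shift w (hat (~: A)%SET); have mw' : mcs w' := mcs_shift mw np.
have [t' tt'] := has_type_ex mw'; exists w', t'; split=> //.
  have : w' (hat (~: A)%SET) by apply: mcs_identity.
  by rewrite hatP // inE.
have [ut' tE'] := tt'; apply: ohead_filter_inj; rewrite ?filter_uniq // => a.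
pose B := [set c : T | (c \notin A) && a c]%SET.
have filterE s :
    [seq c <- [seq c <- s | c \notin A] | a c] = [seq c <- s | c \in B].
  by rewrite -filter_predI; apply: eq_filter => c; rewrite /= finset.in_set andbC.
rewrite !filterE -tE -tE'.
have hatB u : mcs u -> u (hat B) <-> u (Conj (hat (~: A)%SET) (hat B)).
  by move=> mu; rewrite mcs_conj // !hatP // !inE; split=> [/andP[-> ->]|[]].
have eq r : w' (Cond (hat B) r) <-> w (Cond (hat B) r).
  rewrite (mcs_equiv r mw' hatB) (mcs_equiv r mw hatB).
  exact: mcs_flattening.
by apply: select_eq.
Qed.

End Types.

(** * Completeness *)

Fixpoint subformulas (p : form) : seq form :=
  p :: match p with
       | Atom _ => [::]
       | Neg q => subformulas q
       | Conj q r | Cond q r => subformulas q ++ subformulas r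
       end.

Lemma mem_subformulas p : p \in subformulas p.
Proof. by case: p => *; rewrite mem_head. Qed.

Section Countermodel.
Variable L : seq form.
Local Notation T := ((size L).-tuple bool).

(** A list without repetitions is no longer than the number of cells, so the length bound loses
    nothing and makes this a finite type. *)
Definition typ : Type :=
  {t : #|{: T}|.-bseq T | `[< exists2 w, mcs w & has_type w t >]}.
HB.instance Definition _ := Finite.on typ.

Definition typ_seq (x : typ) : seq T := val x.

Lemma typ_mcs_ex x : exists2 w, mcs w & has_type w (typ_seq x).
Proof. by apply/asboolP; apply: valP x. Qed.

Definition typ_mcs x : set form := s2val (cid2 (typ_mcs_ex x)).

Lemma mcs_typ_mcs x : mcs (typ_mcs x).
Proof. exact: s2valP (cid2 (typ_mcs_ex x)). Qed.

Lemma has_type_typ_mcs x : has_type (typ_mcs x) (typ_seq x).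
Proof. exact: s2valP' (cid2 (typ_mcs_ex x)). Qed.

Definition typ_head x : T := cell L (typ_mcs x).

Lemma typ_headE x : ohead (typ_seq x) = Some (typ_head x).
Proof. exact: has_type_head (mcs_typ_mcs x) (has_type_typ_mcs x). Qed.

Lemma typ_of_mcs w (t : seq T) : mcs w -> has_type w t ->
  exists2 x, typ_seq x = t & typ_head x = cell L w.
Proof.
move=> mw tt; have [ut _] := tt.
have t_size : (size t <= #|{: T}|)%N by rewrite -(card_uniqP ut) max_card.
have tP : `[< exists2 w, mcs w & has_type w (Bseq t_size) >].
  by apply/asboolP; exists w.
exists (exist _ (Bseq t_size) tP) => //.
by apply: Some_inj; rewrite -typ_headE -(has_type_head mw tt).
Qed.

Lemma typ_next_ex : exists nx : typ -> {set T} -> typ,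
  forall x (A : {set T}), has (fun c => c \notin A) (typ_seq x) ->
  typ_head (nx x A) \notin A /\
  [seq c <- typ_seq (nx x A) | c \notin A] = [seq c <- typ_seq x | c \notin A].
Proof.
suff /choice[f fP] : forall xA : typ * {set T}, exists y,
    has (fun c => c \notin xA.2) (typ_seq xA.1) ->
    typ_head y \notin xA.2 /\
    [seq c <- typ_seq y | c \notin xA.2] = [seq c <- typ_seq xA.1 | c \notin xA.2].
  by exists (fun x A => f (x, A)) => x A; apply: (fP (x, A)).
move=> [x A] /=; have [hasA|] := boolP (has _ (typ_seq x)); last by exists x.
have [w [t [mw tt wA tE]]] :=
  has_type_flat (mcs_typ_mcs x) (has_type_typ_mcs x) hasA.
by have [y yt yw] := typ_of_mcs mw tt; exists y; rewrite yw yt.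
Qed.

Lemma holds_typ_head x q : q \in L -> holds (typ_head x) q <-> typ_mcs x q.
Proof. by move=> qL; rewrite holds_cell //; split=> /asboolP. Qed.

(** Truth at the walk from [x] is read off the head cell of [x]. For conditionals, [denot_walk_cond]
    and [has_type_cond] both test the consequent at the first cell of the type that satisfies the
    antecedent. *)
Lemma countermodel w phi : mcs w -> {subset subformulas phi <= L} -> ~ w phi ->
  exists (P : Type) (_ : inhabited P) (W : set (oseq P)) (W0 : W !=set0)
         (V : nat -> seqFrame W0 -> bool) (s : seqFrame W0),
  [/\ finite_set W, tail_closed W, forall s, W s -> olen s < omega_omega &
      ~ true_at V phi s].
Proof.
move=> mw phiL nphi; have [nx nxP] := typ_next_ex.
have nx_hd x A h := (nxP x A h).1; have nx_ty x A h := (nxP x A h).2.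
have [t tt] := has_type_ex L mw; have [x0 _ x0w] := typ_of_mcs mw tt.
pose world := walk_world nx_hd x0.
pose V k s := `[< exists x, s = world x /\ holds (typ_head x) (Atom k) >].
exists typ, (inhabits x0), (walk_set nx_hd), (walk_set_nonempty nx_hd x0).
exists V, (world x0).
split; first exact: walk_set_finite.
- exact: walk_set_tail_closed.
- by move=> _ [x _ <-]; apply: walk_seq_lt.
have split_qr q r : {subset subformulas q ++ subformulas r <= L} ->
    {subset subformulas q <= L} /\ {subset subformulas r <= L}.
  by move=> sub; split=> p pL; apply: sub; rewrite mem_cat pL ?orbT.
suff truth q : {subset subformulas q <= L} ->
    forall x, denot V q (world x) <-> holds (typ_head x) q.
  move=> /truth-/(_ phiL); rewrite x0w holds_cell; last first.
    exact/phiL/mem_subformulas.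
  by move=> /asboolP.
elim: q => [k|q IH|q IHq r IHr|q IHq r IHr] qL x.
- split=> [/asboolP[y [xy]]|hx]; last by apply/asboolP; exists x.
  (* Distinct states start distinct walks, so the valuation is unambiguous. *)
  by rewrite (walk_seq_inj (congr1 val xy)).
- have qL' : {subset subformulas q <= L}.
    by move=> p pq; apply: qL; rewrite inE pq orbT.
  have Lq := qL' _ (mem_subformulas q); have LNq := qL _ (mem_subformulas _).
  rewrite (holds_typ_head x LNq) (mcs_neg _ (mcs_typ_mcs x)).
  by rewrite -(holds_typ_head x Lq) -(IH qL').
- have [qL' rL'] := split_qr _ _ (fun p => qL p \o (@mem_behead _ (_ :: _) p)).
  have Lq := qL' _ (mem_subformulas q); have Lr := rL' _ (mem_subformulas r).
  have Lqr := qL _ (mem_subformulas _).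
  rewrite (holds_typ_head x Lqr) (mcs_conj _ _ (mcs_typ_mcs x)).
  by rewrite -(holds_typ_head x Lq) -(holds_typ_head x Lr) -(IHq qL') -(IHr rL').
- have [qL' rL'] := split_qr _ _ (fun p => qL p \o (@mem_behead _ (_ :: _) p)).
  have Lq := qL' _ (mem_subformulas q); have Lr := rL' _ (mem_subformulas r).
  have Lqr := qL _ (mem_subformulas _).
  apply: iff_trans (denot_walk_cond typ_headE nx_ty x (IHq qL') (IHr rL')) _.
  rewrite (holds_typ_head x Lqr); apply: iff_sym.
  exact: has_type_cond (mcs_typ_mcs x) (has_type_typ_mcs x) Lq Lr.
Qed.

End Countermodel.

Theorem theorem6p2 :
  (forall p : form, C2F p ->
     forall (P : Type) (P0 : inhabited P) (W : set (oseq P)) (W0 : W !=set0)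
            (V : nat -> seqFrame W0 -> bool) (w : seqFrame W0),
       true_at V p w)
  /\
  (forall p : form,
     (forall (P : Type) (P0 : inhabited P) (W : set (oseq P)) (W0 : W !=set0)
             (V : nat -> seqFrame W0 -> bool),
        finite_set W ->
        tail_closed W ->
        (forall s, W s -> olen s < omega_omega) ->
        forall w : seqFrame W0, true_at V p w) ->
     C2F p).
Proof.
split=> [p Cp P _ W W0 V w|p valid].
  exact: C2F_sound (@flat_seqFrame P W W0) Cp.
apply: contrapT => /mcs_avoiding[w mw np].
have [P [P0 [W [W0 [V [s [Wfin Wtail Wlen]]]]]]] :=
  countermodel mw (fun q => id) np.
by apply; apply: valid.
Qed.
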